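(* Let $(K,\mathcal{W})$ be a generalized amalgam separation of a graph $G=(V,E)$ such that $K$ is a clique, and let $\mathcal{L}=\mathcal{L}(K,\mathcal{W})$. Then $P(G)$ consists of the restrictions $x_G$ of those vectors $x\in\mathbb{R}^{V\cup\bigcup\{\mathcal{P}(\mathcal{A}_W):W\in\mathcal{W}\}}$ satisfying $$x_{\Gamma(K,\mathcal{W})}\in P(\Gamma(K,\mathcal{W}),\mathcal{L})\quad\text{and}\quad x_{G(K,W)}\in P(G(K,W))\ \text{for all }W\in\mathcal{W}.$$
   Context: A generalized amalgam separation of $G=(V,E)$ is a pair $(U,\mathcal{W})$ with $U\subseteq V$ and $\mathcal{W}$ a partition of $V\setminus U$ into nonempty sets $W$ such that each node of $W$ with a neighbor outside $W\cup U$ is adjacent to every node of $U$. Here $U=K$ is a clique. For $W\in\mathcal{W}$, let $\partial(W)$ be the set of nodes of $W$ having a neighbor in $V\setminus(W\cup K)$, and let $\mathcal{A}_W$ be the collection of equivalence classes of $\partial(W)$ under the relation ''having the same neighbors outside $W$''. Let $\mathcal{P}(\mathcal{A}_W)$ be a clique of new nodes $r_{\mathcal{X}}$, one for each subcollection $\mathcal{X}\subseteq\mathcal{A}_W$ (these cliques are disjoint for different $W$). $G(K,W)$ is obtained from the disjoint union of $G_{K\cup W}$ and $\mathcal{P}(\mathcal{A}_W)$ by joining each $r_{\mathcal{X}}$ to all nodes of $\partial(W)\setminus\bigcup\mathcal{X}$ and to all nodes of $K$. $\Gamma(K,\mathcal{W})$ is obtained from the disjoint union of the clique $K$ and all cliques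 $\mathcal{P}(\mathcal{A}_W)$, $W\in\mathcal{W}$, by joining every node of $K$ to every node of every $\mathcal{P}(\mathcal{A}_W)$, and adding all edges $r_{\mathcal{X}}r_{\mathcal{X}'}$ with $\mathcal{X}\subseteq\mathcal{A}_W$, $\mathcal{X}'\subseteq\mathcal{A}_{W'}$, $W\ne W'$, such that $\bigcup\mathcal{X}$ and $\bigcup\mathcal{X}'$ are adjacent in $G$ (some node of one has a neighbor in the other). $\mathcal{L}(K,\mathcal{W})=\{K\cup\mathcal{P}(\mathcal{A}_W):W\in\mathcal{W}\}$. For a graph $H$ and a collection $\mathcal{L}$ of cliques, $P(H,\mathcal{L})$ is the convex hull of characteristic vectors of stable sets of $H$ meeting every member of $\mathcal{L}$; $P(H)=P(H,\emptyset)$. $x_H$ denotes the restriction of $x$ to the nodes of $H$. *)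

(* Defs.v *)
From HB Require Import structures.
From mathcomp Require Import all_boot all_order all_algebra.
From mathcomp Require Import reals.

Set Implicit Arguments.
Unset Strict Implicit.
Unset Printing Implicit Defensive.

Import GRing.Theory.
Local Open Scope ring_scope.

Record sgraph := SGraph {
  vertex :> finType;
  adj : rel vertex;
  adj_sym : symmetric adj;
  adj_irr : irreflexive adj }.

Definition clique (G : sgraph) (A : {set G}) : bool :=
  [forall u in A, forall v in A, (u != v) ==> adj u v].

Definition stable (G : sgraph) (A : {set G}) : bool :=
  [forall u in A, forall v in A, ~~ adj u v].

Definition convex_hull (R : realType) (V : lmodType R) (A : V -> Prop) (x : V) :
    Prop :=
  exists (n : nat) (c : 'I_n -> R) (p : 'I_n -> V),
    [/\ forall i, A (p i), forall i, 0 <= c i, \sum_(i < n) c i = 1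
      & x = \sum_(i < n) c i *: p i].

(* R^o is R seen as a module over itself, so that {ffun G -> R^o} is the
   R-vector space R^V, for V the set of nodes of G. *)
Definition char_vector (R : realType) (G : sgraph) (S : {set G}) :
    {ffun G -> R^o} :=
  [ffun v => (v \in S)%:R].

(* P(G, L); P(G) is the case L = set0. *)
Definition stable_polytope (R : realType) (G : sgraph) (L : {set {set G}}) :
    {ffun G -> R^o} -> Prop :=
  convex_hull (fun x => exists S : {set G},
    [/\ stable S, forall C, C \in L -> S :&: C != set0 & x = char_vector R S]).

(* mathcomp's [partition] already requires the blocks to be nonempty. *)
Definition amalgam_separation (G : sgraph) (U : {set G})
    (WW : {set {set G}}) : Prop :=
  partition WW (~: U) /\
  forall W w, W \in WW -> w \in W ->
    (exists2 v, v \notin W :|: U & adj w v) ->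
    forall u, u \in U -> adj w u.

Definition boundary (G : sgraph) (K W : {set G}) : {set G} :=
  [set w in W | [exists v, (v \notin W :|: K) && adj w v]].

Definition same_outside (G : sgraph) (W : {set G}) : rel G :=
  fun u v => [forall z, (z \notin W) ==> (adj u z == adj v z)].

(* The collection A_W. *)
Definition classes (G : sgraph) (K W : {set G}) : {set {set G}} :=
  equivalence_partition (same_outside W) (boundary K W).

Definition adjacent_sets (G : sgraph) (A B : {set G}) : bool :=
  [exists u in A, exists v in B, adj u v].

(* The nodes r_X of the clique P(A_W): r_X is represented by X itself. *)
Definition pnode (G : sgraph) (K W : {set G}) : finType :=
  {X : {set {set G}} | X \subset classes K W}.

Definition block (G : sgraph) (WW : {set {set G}}) : finType :=
  {W : {set G} | W \in WW}.

(* The disjoint union of the P(A_W); the tag of a node is its block W. *)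
Definition newnode (G : sgraph) (K : {set G}) (WW : {set {set G}}) : finType :=
  {W : block WW & pnode K (val W)}.

Definition new_union (G : sgraph) (K : {set G}) (WW : {set {set G}})
    (r : newnode K WW) : {set G} :=
  cover (val (tagged r)).

Section GKW.

Context (G : sgraph) (K W : {set G}).

Definition GKW_vertex : finType := ({v : G | v \in K :|: W} + pnode K W)%type.

Definition GKW_cross (v : G) (X : {set {set G}}) : bool :=
  (v \in boundary K W :\: cover X) || (v \in K).

Definition GKW_adj : rel GKW_vertex := fun a b =>
  match a, b with
  | inl u, inl v => adj (val u) (val v)
  | inl u, inr X => GKW_cross (val u) (val X)
  | inr X, inl v => GKW_cross (val v) (val X)
  | inr X, inr Y => X != Y
  end.

Lemma GKW_sym : symmetric GKW_adj.
Proof. by move=> [u|X] [v|Y] //=; [apply: adj_sym | rewrite eq_sym]. Qed.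

Lemma GKW_irr : irreflexive GKW_adj.
Proof. by move=> [u|X] /=; [apply: adj_irr | rewrite eqxx]. Qed.

Definition GKW : sgraph := SGraph GKW_sym GKW_irr.

End GKW.

Section Gamma.

Context (G : sgraph) (K : {set G}) (WW : {set {set G}}).

Definition Gamma_vertex : finType := ({v : G | v \in K} + newnode K WW)%type.

Definition Gamma_adj : rel Gamma_vertex := fun a b =>
  match a, b with
  | inl u, inl v => u != v
  | inl _, inr _ | inr _, inl _ => true
  | inr r, inr s =>
      if tag r == tag s then r != s
      else adjacent_sets (new_union r) (new_union s)
  end.

Lemma adjacent_sets_sym : symmetric (@adjacent_sets G).
Proof.
suff H (A B : {set G}) : adjacent_sets A B -> adjacent_sets B A.
  by move=> A B; apply/idP/idP; apply: H.
move=> /existsP[u /andP[uA /existsP[v /andP[vB uv]]]].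
apply/existsP; exists v; rewrite vB /=.
by apply/existsP; exists u; rewrite uA adj_sym.
Qed.

Lemma Gamma_sym : symmetric Gamma_adj.
Proof.
move=> [u|r] [v|s] //=; first by rewrite eq_sym.
by rewrite [tag s == _]eq_sym [s == _]eq_sym adjacent_sets_sym.
Qed.

Lemma Gamma_irr : irreflexive Gamma_adj.
Proof. by move=> [u|r] /=; rewrite !eqxx. Qed.

Definition Gamma : sgraph := SGraph Gamma_sym Gamma_irr.

(* The collection of the cliques K :|: P(A_W) of Gamma(K, WW), W in WW. *)
Definition Gamma_cliques : {set {set Gamma}} :=
  [set [set v : Gamma_vertex | if v is inr r then tag r == W else true]
     | W in [set: block WW]].

Definition ext_vertex : finType := (G + newnode K WW)%type.

Definition G_incl (v : G) : ext_vertex := inl v.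

Definition Gamma_incl (v : Gamma) : ext_vertex :=
  match v with inl k => inl (val k) | inr r => inr r end.

Definition GKW_incl (W : block WW) (v : GKW K (val W)) : ext_vertex :=
  match v with
  | inl u => inl (val u)
  | inr X => inr (Tagged (fun W : block WW => pnode K (val W)) X)
  end.

End Gamma.

(* x_H, for f the inclusion of the nodes of H into the index set of x. *)
Definition restrict (R : realType) (A B : finType) (f : A -> B)
    (x : {ffun B -> R^o}) : {ffun A -> R^o} :=
  [ffun a => x (f a)].

(* Main.v *)
Require Import Defs.
From HB Require Import structures.
From mathcomp Require Import all_boot all_order all_algebra.
From mathcomp Require Import reals.

Set Implicit Arguments.
Unset Strict Implicit.
Unset Printing Implicit Defensive.

Import Order.TTheory GRing.Theory Num.Theory.
Local Open Scope ring_scope.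

(* A stable set S of G extends to the new nodes: if S misses K, add in each
   P(A_W) the node r_X, with X the set of classes met by S; this gives one
   inclusion. Conversely, write x on Gamma and on each G(K, W) as the mean of a
   random stable set. Since K and P(A_W) together form a clique that is met with
   probability 1 in Gamma, hence also in G(K, W), the law of the node selected in
   that clique is determined by x. One may thus draw the stable set of Gamma first
   and then those of the G(K, W), independently conditionally on the selected
   nodes. These sets glue to a stable set of G: if a node of K is selected, no
   node of any boundary is; otherwise the nodes selected in boundary(W) lie in the
   union of the X with r_X selected, and these unions are pairwise nonadjacent. *)

(** * Conditionally independent coupling of finite laws *)

(** The law [rho] draws [s] from [la], then each [t i] independently from [mu i] conditioned on
    [g i (t i) = f i s]. Equality of the image laws makes the marginals come out right; the last two
    conclusions state these marginals as expectations. *)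
Lemma weighted_glue (R : realFieldType) (I S T Z : finType)
    (la : S -> R) (mu : I -> T -> R) (f : I -> S -> Z) (g : I -> T -> Z) :
    (forall s, 0 <= la s) -> \sum_s la s = 1 ->
    (forall i t, 0 <= mu i t) -> (forall i, \sum_t mu i t = 1) ->
    (forall i z, \sum_(s | f i s == z) la s = \sum_(t | g i t == z) mu i t) ->
  exists rho : S * {ffun I -> T} -> R,
    [/\ forall w, 0 <= rho w,
        \sum_w rho w = 1,
        forall w, rho w != 0 ->
          la w.1 != 0 /\ forall i, mu i (w.2 i) != 0 /\ f i w.1 = g i (w.2 i),
        forall h : S -> R, \sum_w rho w * h w.1 = \sum_s la s * h s
      & forall i (h : T -> R),
          \sum_w rho w * h (w.2 i) = \sum_t mu i t * h t].
Proof.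
move=> la0 la1 mu0 mu1 lamu.
pose m i z := \sum_(t | g i t == z) mu i t.
(* The law of the i-th component given s; the first branch is a junk value that
   keeps [ka i s] a probability even where the conditioning event has mass 0. *)
pose ka i s t := if m i (f i s) == 0 then mu i t
  else (g i t == f i s)%:R * mu i t / m i (f i s).
have m0 i z : 0 <= m i z by apply: sumr_ge0.
have ka0 i s t : 0 <= ka i s t.
  by rewrite /ka; case: ifP => // _; rewrite divr_ge0 ?mulr_ge0 ?ler0n.
have ka1 i s : \sum_t ka i s t = 1.
  rewrite /ka; case: eqP => [_|/eqP mN0]; first exact: mu1.
  rewrite -mulr_suml; apply: (canLR (mulfK mN0)).
  rewrite mul1r /m [RHS]big_mkcond.
  by apply: eq_bigr => t _; case: eqP => _; rewrite ?mul1r ?mul0r.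
(* A value taken with positive [la]-mass also has positive mass under [mu i], so the junk branch of
   [ka] is never reached on the support of [la]. *)
have mN0 i s : la s != 0 -> m i (f i s) != 0.
  move=> lsN0; apply: contraNneq lsN0 => ms0; move: ms0.
  rewrite /m -lamu => /eqP; rewrite psumr_eq0 // => /allP/(_ s).
  by rewrite mem_index_enum eqxx => /(_ isT).
pose rho (w : S * {ffun I -> T}) := la w.1 * \prod_i ka i w.1 (w.2 i).
have sumrho s : \sum_(t : {ffun I -> T}) \prod_i ka i s (t i) = 1.
  rewrite -(bigA_distr_bigA (fun i t => ka i s t)) big1 // => i _; exact: ka1.
have rho_fst h : \sum_w rho w * h w.1 = \sum_s la s * h s.
  rewrite -(pair_bigA _ (fun s t => rho (s, t) * h s)) /=.
  apply: eq_bigr => s _.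
  by rewrite -mulr_suml -[in RHS](mulr1 (la s)) -(sumrho s) mulr_sumr.
exists rho; split=> //.
- by move=> w; rewrite mulr_ge0 ?prodr_ge0.
- under eq_bigr do rewrite -[rho _]mulr1.
  rewrite (rho_fst (fun=> 1)) -[RHS]la1.
  by apply: eq_bigr => s _; rewrite mulr1.
- move=> [s t]; rewrite /rho /= mulf_eq0 negb_or => /andP[lsN0 /prodf_neq0 kN0].
  split=> // i; have := kN0 i isT; rewrite /ka (negPf (mN0 i s lsN0)).
  rewrite !mulf_eq0 !negb_or => /andP[/andP[gf ->] _]; split=> //.
  by case: (g i (t i) =P f i s) gf => [->|_] //; rewrite mulr0n eqxx.
move=> i h.
rewrite -(pair_bigA _ (fun s (t : {ffun I -> T}) => rho (s, t) * h (t i))) /=.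
have step s : \sum_(t : {ffun I -> T}) rho (s, t) * h (t i) =
    \sum_t la s * ka i s t * h t.
  (* With [h] absorbed into the [i]-th factor, the sum over functions becomes a product of sums, in
     which every factor but the [i]-th is 1. *)
  pose F j t := ka j s t * (if j == i then h t else 1).
  transitivity (la s * \sum_(t : {ffun I -> T}) \prod_j F j (t j)).
    rewrite mulr_sumr; apply: eq_bigr => t _; rewrite /rho /= -mulrA.
    congr (_ * _).
    rewrite /F big_split /=; congr (_ * _).
    by rewrite -big_mkcond big_pred1_eq.
  rewrite -(bigA_distr_bigA F) (bigD1 i) //= [X in _ * (_ * X)]big1 => [|j ji].
    rewrite mulr1 mulr_sumr; apply: eq_bigr => t _.
    by rewrite /F eqxx mulrA.
  rewrite -[RHS](ka1 j s); apply: eq_bigr => t _.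
  by rewrite /F (negPf ji) mulr1.
under eq_bigr do rewrite step.
rewrite exchange_big /=; apply: eq_bigr => t _.
rewrite -mulr_suml; congr (_ * _).
(* Only the [s] with [f i s = g i t] contribute; their total mass [m i (g i t)] cancels the
   denominator. *)
transitivity (\sum_(s | f i s == g i t) la s * (mu i t / m i (g i t))).
  rewrite [RHS]big_mkcond; apply: eq_bigr => s _.
  have [->|lsN0] := eqVneq (la s) 0; first by rewrite !mul0r if_same.
  rewrite /ka (negPf (mN0 i s lsN0)) eq_sym.
  by case: eqP => [->|_]; rewrite ?mul1r // !mul0r mulr0.
rewrite -mulr_suml lamu -/(m i (g i t)).
(* If that mass is 0, then so is [mu i t], one of its nonnegative summands. *)
have [mz|mN] := eqVneq (m i (g i t)) 0; last by rewrite mulrC divfK.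
rewrite mz mul0r; apply/esym/eqP.
move/eqP: mz; rewrite /m psumr_eq0 // => /allP/(_ t).
by rewrite mem_index_enum eqxx => /(_ isT).
Qed.

(** * Stable set polytopes as laws on subsets of a common node set *)

Section Weights.

Context (R : realType) (H : sgraph) (B : finType) (f : H -> B).
Context (L : {set {set H}}).

(** Lets a single family of subsets of [B] certify membership for every graph mapped into [B]. Only
    indices of nonzero weight are constrained, since a coupling controls nothing outside its
    support. *)
Lemma restrict_polytope_intro (I : finType) (c : I -> R) (N : I -> {set B})
    (x : {ffun B -> R^o}) :
    (forall i, 0 <= c i) -> \sum_i c i = 1 ->
    (forall i, c i != 0 -> stable (f @^-1: N i) /\
       forall C, C \in L -> f @^-1: N i :&: C != set0) ->
    (forall a, x (f a) = \sum_i c i * (f a \in N i)%:R) ->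
  stable_polytope L (restrict f x).
Proof.
move=> c0 c1 cN xN.
(* A convex hull asks every point to be admissible, even at weight 0; such indices are redirected to
   some [i0] of nonzero weight. *)
have /existsP[i0 ci0] : [exists i, c i != 0].
  apply: contraT; rewrite negb_exists => /forallP cz.
  move/eqP: c1; rewrite big1 => [|i _]; first by rewrite eq_sym oner_eq0.
  by apply/eqP; rewrite -[_ == _]negbK.
pose M i := f @^-1: N (if c i == 0 then i0 else i).
exists #|I|, (fun j => c (enum_val j)),
  (fun j => char_vector R (M (enum_val j))).
split=> //.
- move=> j; exists (M (enum_val j)); rewrite /M; case: eqP => [_|/eqP cj].
    by have [] := cN i0 ci0.
  by have [] := cN _ cj.
- rewrite -c1 [RHS](reindex (@enum_val I I)) //.
  by apply: onW_bij; apply: enum_val_bij.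
apply/ffunP => a; rewrite ffunE xN sum_ffunE.
rewrite (reindex (@enum_val I I)) /=; last by apply: onW_bij; apply: enum_val_bij.
apply: eq_bigr => j _; rewrite !ffunE /M inE.
by case: eqP => // ->; rewrite mul0r scale0r.
Qed.

(** The convex combination is pushed forward along [S |-> f @: S], adding the weights of points with
    equal image; injectivity of [f] recovers [S] as a preimage. *)
Lemma restrict_polytope_elim (x : {ffun B -> R^o}) : injective f ->
    stable_polytope L (restrict f x) ->
  exists c : {set B} -> R,
    [/\ forall N, 0 <= c N, \sum_N c N = 1,
        forall N, c N != 0 -> stable (f @^-1: N) /\
          forall C, C \in L -> f @^-1: N :&: C != set0
      & forall a, x (f a) = \sum_N c N * (f a \in N)%:R].
Proof.
move=> fI [n [c [p [/fin_all_exists[S pS] c0 c1 xE]]]].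
have fK i : f @^-1: (f @: S i) = S i by apply/setP => a; rewrite inE mem_imset.
exists (fun N => \sum_(i | f @: S i == N) c i); split=> [N| |N|a].
- exact: sumr_ge0.
- by rewrite -c1 [RHS](partition_big (fun i => f @: S i) predT).
- move=> cN; case: (pickP (fun i => f @: S i == N)) => [i /eqP <-|nN].
    by rewrite fK; have [] := pS i.
  by rewrite big_pred0 ?eqxx in cN.
have := congr1 (fun y : {ffun H -> R^o} => y a) xE.
rewrite ffunE sum_ffunE => ->.
rewrite (partition_big (fun i => f @: S i) predT) //=; apply: eq_bigr => N _.
rewrite mulr_suml; apply: eq_bigr => i /eqP <-.
by rewrite ffunE; have [_ _ ->] := pS i; rewrite ffunE mem_imset.
Qed.

End Weights.

(** * The trace of a random set on a clique *)

Section Traces.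

Context (R : realFieldType) (B : finType) (C : {set B}).

Lemma sum_weight_trace (c : {set B} -> R) :
  \sum_N c N * #|N :&: C|%:R = \sum_(a in C) \sum_N c N * (a \in N)%:R.
Proof.
rewrite exchange_big /=; apply: eq_bigr => N _.
rewrite -mulr_sumr; congr (_ * _).
rewrite -sum1_card natr_sum big_mkcond [RHS]big_mkcond /=.
by apply: eq_bigr => a _; rewrite inE andbC; do 2!case: (a \in _).
Qed.

(** A variable bounded by 1 with mean 1 equals 1 almost surely: its defect is nonnegative with mean
    0. *)
Lemma trace_card1 (c : {set B} -> R) :
    (forall N, 0 <= c N) -> \sum_N c N = 1 ->
    (forall N, c N != 0 -> (#|N :&: C| <= 1)%N) ->
    \sum_N c N * #|N :&: C|%:R = 1 ->
  forall N, c N != 0 -> #|N :&: C| = 1%N.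
Proof.
move=> c0 c1 cle cC N cN.
have d0 M : 0 <= c M * (1 - #|M :&: C|%:R).
  have [->|cM] := eqVneq (c M) 0; first by rewrite mul0r.
  by rewrite mulr_ge0 // subr_ge0 lern1 cle.
have : \sum_M c M * (1 - #|M :&: C|%:R) = 0.
  under eq_bigr do rewrite mulrBr mulr1.
  by rewrite sumrB c1 cC subrr.
move=> /eqP; rewrite psumr_eq0 // => /allP/(_ N); rewrite mem_index_enum.
move=> /(_ isT); rewrite mulf_eq0 (negPf cN) subr_eq0 eq_sym pnatr_eq1.
by move=> /eqP.
Qed.

Lemma trace_weight_set1 (c : {set B} -> R) (a : B) : a \in C ->
    (forall N, c N != 0 -> #|N :&: C| = 1%N) ->
  \sum_(N | N :&: C == [set a]) c N = \sum_N c N * (a \in N)%:R.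
Proof.
move=> aC c1; rewrite big_mkcond; apply: eq_bigr => N _.
have [->|cN] := eqVneq (c N) 0; first by rewrite mul0r if_same.
have /eqP/cards1P[b Nb] := c1 N cN.
have -> : (a \in N) = (a == b) by rewrite -in_set1 -Nb inE aC andbT.
by rewrite Nb (inj_eq set1_inj) eq_sym; case: eqP; rewrite ?mulr1 ?mulr0.
Qed.

(** An almost surely one-point trace has its law given by the node marginals on [C]; any [Z] that is
    not a singleton of [C] has mass 0 on both sides. *)
Lemma trace_weight_eq (c d : {set B} -> R) :
    (forall N, c N != 0 -> #|N :&: C| = 1%N) ->
    (forall N, d N != 0 -> #|N :&: C| = 1%N) ->
    (forall a, a \in C ->
       \sum_N c N * (a \in N)%:R = \sum_N d N * (a \in N)%:R) ->
  forall Z, \sum_(N | N :&: C == Z) c N = \sum_(N | N :&: C == Z) d N.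
Proof.
move=> c1 d1 cd Z.
case: (pickP [pred a in C | Z == [set a]]) => [a /andP[aC /eqP->]|nZ].
  by rewrite !trace_weight_set1 // cd.
have z0 (e : {set B} -> R) : (forall N, e N != 0 -> #|N :&: C| = 1%N) ->
    \sum_(N | N :&: C == Z) e N = 0.
  move=> e1; rewrite big1 // => N /eqP NZ; apply/eqP; apply: contraT.
  move=> /e1/eqP/cards1P[a Na]; have := nZ a; rewrite /= -NZ Na eqxx andbT.
  suff: a \in N :&: C by rewrite inE => /andP[_ ->].
  by rewrite Na inE.
by rewrite !z0.
Qed.

End Traces.

Lemma clique_trace_le1 (H : sgraph) (B : finType) (f : H -> B) (C N : {set B}) :
    {in C &, forall e e', e != e' ->
       exists a b, [/\ f a = e, f b = e' & adj a b]} ->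
  stable (f @^-1: N) -> (#|N :&: C| <= 1)%N.
Proof.
move=> cl st; apply/card_le1_eqP => e e'; rewrite !inE.
move=> /andP[eN eC] /andP[e'N e'C]; apply/eqP; apply: contraT.
move=> nee; have [a [b [fa fb ab]]] := cl _ _ e'C eC nee.
have := forall_inP st a; rewrite inE fa e'N => /(_ isT)/forall_inP/(_ b).
by rewrite inE fb eN ab => /(_ isT).
Qed.

(** * Classes of boundary nodes *)

Section Classes.

Context (G : sgraph) (K W : {set G}).

Lemma classes_same (A : {set G}) : A \in classes K W ->
  {in A &, forall u v, forall z, z \notin W -> adj u z = adj v z}.
Proof.
case/imsetP => a _ -> u v; rewrite !inE.
move=> /andP[_ /forall_inP au] /andP[_ /forall_inP av] z zW.
by rewrite -(eqP (au z zW)) (eqP (av z zW)).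
Qed.

Lemma classes_sub_boundary (A : {set G}) : A \in classes K W ->
  A \subset boundary K W.
Proof.
by case/imsetP => a _ ->; apply/subsetP => u; rewrite !inE; case/andP.
Qed.

Lemma boundary_class (u : G) : u \in boundary K W ->
  exists2 A, A \in classes K W & u \in A.
Proof.
move=> ub; exists [set v in boundary K W | same_outside W u v].
  exact: imset_f.
by rewrite inE ub; apply/forall_inP => z _.
Qed.

End Classes.

Lemma stableP (G : sgraph) (S : {set G}) :
  reflect {in S &, forall u v, ~~ adj u v} (stable S).
Proof.
apply: (iffP forall_inP) => [st u v uS vS|st u uS].
  by have /forall_inP := st u uS; apply.
by apply/forall_inP => v; apply: st.
Qed.

(** * Blocks and boundaries of the separation *)

Section Separation.

Context (G : sgraph) (K : {set G}) (WW : {set {set G}}).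
Hypotheses (sepKW : amalgam_separation K WW) (clK : clique K).

Lemma block_notin_clique (W : {set G}) (v : G) :
  W \in WW -> v \in W -> v \notin K.
Proof.
move=> WWW vW; have [/cover_partition covW _] := sepKW.
by rewrite -in_setC -covW; apply/bigcupP; exists W.
Qed.

Lemma block_exists (v : G) : v \notin K -> exists W : block WW, v \in val W.
Proof.
have [/cover_partition covW _] := sepKW.
by rewrite -in_setC -covW => /bigcupP[W WWW vW]; exists (Sub W WWW).
Qed.

Lemma block_inj (W W' : block WW) (v : G) :
  v \in val W -> v \in val W' -> W = W'.
Proof.
move=> vW vW'; have [/and3P[_ /trivIsetP tr _] _] := sepKW.
apply/val_inj/eqP; apply: contraT => /(tr _ _ (valP W) (valP W')).
by move=> /pred0P/(_ v) /=; rewrite vW vW'.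
Qed.

Lemma boundary_adj (W : block WW) (u k : G) :
  u \in boundary K (val W) -> k \in K -> adj u k.
Proof.
rewrite inE => /andP[uW /existsP[v /andP[vWK uv]]] kK.
by have [_ sep] := sepKW; apply: (sep _ u (valP W) uW) => //; exists v.
Qed.

Lemma cross_boundary (W W' : block WW) (u v : G) : W != W' ->
  u \in val W -> v \in val W' -> adj u v -> u \in boundary K (val W).
Proof.
move=> WW' uW vW' uv; rewrite inE uW; apply/existsP; exists v.
rewrite uv andbT inE (negPf (block_notin_clique (valP W') vW')) orbF.
by apply: contra WW' => vW; rewrite (block_inj vW vW').
Qed.

(** * Extending a stable set to the new nodes *)

Definition stable_trace (W S : {set G}) : {set {set G}} :=
  [set A in classes K W | A :&: S != set0].

Lemma stable_trace_sub (W S : {set G}) : stable_trace W S \subset classes K W.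
Proof. by apply/subsetP => A; rewrite inE => /andP[]. Qed.

(** When [S] meets [K], that node of [K] already hits every clique made of [K] and a [P(A_W)], so no
    new node may be added. *)
Definition extend (S : {set G}) : {set ext_vertex K WW} :=
  [set e | match e with
           | inl v => v \in S
           | inr r => [disjoint S & K] &&
               (val (tagged r) == stable_trace (val (tag r)) S)
           end].

Lemma stable_extend_Gamma (S : {set G}) : stable S ->
  stable (@Gamma_incl G K WW @^-1: extend S).
Proof.
move=> /stableP stS; apply/stableP => -[[k kK]|r] [[l lK]|s]; rewrite !inE /=.
- move=> kS lS; apply/negP; rewrite -val_eqE /= => kl.
  have /forall_inP/(_ l lK)/implyP := forall_inP clK k kK.
  by move=> /(_ kl); apply/negP/stS.
- by move=> kS /andP[/pred0P/(_ k) /=]; rewrite kS kK.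
- move=> /andP[/pred0P/(_ l) /=]; rewrite lK andbT => lS _ lS'.
  by rewrite lS' in lS.
move=> /andP[_ /eqP rS] /andP[_ /eqP sS]; case: eqP => [|/eqP rs].
  case: r s rS sS => [W X] [W' Y] /= XS YS WW'; case: _ / WW' in Y YS *.
  rewrite negbK; apply/eqP; congr existT.
  by apply: val_inj; apply: etrans XS (esym YS).
apply/negP => /existsP[u /andP[]]; rewrite (congr1 cover rS : new_union r = _).
rewrite (congr1 cover sS : new_union s = _).
move=> /bigcupP[A]; rewrite inE => /andP[AW /set0Pn[a /setIP[aA aS]]] uA.
move=> /existsP[v /andP[/bigcupP[B]]].
rewrite inE => /andP[BW /set0Pn[b /setIP[bB bS]]] vB uv.
have inW (W : block WW) D z : D \in classes K (val W) -> z \in D -> z \in val W.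
  move=> /classes_sub_boundary/subsetP sub /sub.
  by rewrite inE => /andP[].
have vr : v \notin val (tag r).
  by apply: contra rs => vr; rewrite (block_inj vr (inW _ _ _ BW vB)).
have as_ : a \notin val (tag s).
  by apply: contra rs => ar; rewrite (block_inj (inW _ _ _ AW aA) ar).
(* Nodes of a class agree outside their block, so the edge [uv] moves to [av] and then to [ab],
   joining two nodes of [S]. *)
have := stS a b aS bS; rewrite adj_sym (classes_same BW bB vB as_) adj_sym.
by rewrite -(classes_same AW uA aA vr) uv.
Qed.

Lemma extend_meets (S : {set G}) (C : {set Gamma K WW}) :
  C \in Gamma_cliques K WW -> @Gamma_incl G K WW @^-1: extend S :&: C != set0.
Proof.
case/imsetP => W _ ->; apply/set0Pn.
have [SK|/pred0Pn[k /= /andP[kS kK]]] := boolP [disjoint S & K]; last first.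
  by exists (inl (Sub k kK)); rewrite !inE /= kS.
exists (inr (Tagged (fun W : block WW => pnode K (val W))
               (Sub _ (stable_trace_sub (val W) S) : pnode K (val W)))).
by rewrite !inE /= SK !eqxx.
Qed.

Lemma stable_extend_GKW (S : {set G}) (W : block WW) : stable S ->
  stable (@GKW_incl G K WW W @^-1: extend S).
Proof.
(* A boundary node [u] of [S] lies in a class that meets [S] at [u] itself, hence in the union of
   the trace, whose nodes are not joined to [r_X]. *)
have cross u (X : {set {set G}}) : [disjoint S & K] -> u \in S ->
    X = stable_trace (val W) S -> ~~ GKW_cross K (val W) u X.
  move=> SK uS ->; have uK : u \notin K.
    by have := pred0P SK u; rewrite /= uS /= => ->.
  rewrite /GKW_cross (negPf uK) orbF inE negb_and negbK orbC -implybE.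
  apply/implyP => /boundary_class[A AW uA]; apply/bigcupP; exists A => //.
  by rewrite inE AW; apply/set0Pn; exists u; rewrite inE uA.
move=> /stableP stS; apply/stableP => -[[u uW]|X] [[v vW]|Y]; rewrite !inE /=.
- exact: stS.
- by move=> uS /andP[SK /eqP XS]; apply: cross.
- by move=> /andP[SK /eqP XS] uS; apply: cross.
move=> /andP[_ /eqP XS] /andP[_ /eqP YS].
by rewrite negbK; apply/eqP/val_inj; apply: etrans XS (esym YS).
Qed.

(** * The clique shared by [Gamma] and [G(K, W)] *)

Definition cut (W : block WW) : {set ext_vertex K WW} :=
  [set e | match e with inl v => v \in K | inr r => tag r == W end].

Lemma clique_neq_adj (u v : G) : u \in K -> v \in K -> u != v -> adj u v.
Proof.
by move=> uK vK; have /forall_inP/(_ v vK)/implyP := forall_inP clK u uK.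
Qed.

Lemma cut_Gamma (W : block WW) (e : ext_vertex K WW) : e \in cut W ->
  exists a, @Gamma_incl G K WW a = e.
Proof.
case: e => [k|r]; rewrite inE => eW; first by exists (inl (Sub k eW)).
by exists (inr r).
Qed.

Lemma cut_GKW (W : block WW) (e : ext_vertex K WW) : e \in cut W ->
  exists a, @GKW_incl G K WW W a = e.
Proof.
case: e => [k|[W' X]]; rewrite inE /= => eW.
  by have kKW : k \in K :|: val W by [rewrite inE eW]; exists (inl (Sub k kKW)).
by move: X; rewrite (eqP eW) => X; exists (inr X).
Qed.

Lemma GKW_incl_inj (W : block WW) : injective (@GKW_incl G K WW W).
Proof.
move=> [u|X] [v|Y] //=; first by case=> /val_inj ->.
by case=> /eqP; rewrite eq_Tagged => /eqP /= ->.
Qed.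

Lemma Gamma_incl_inj : injective (@Gamma_incl G K WW).
Proof. by move=> [u|r] [v|s] //=; [case=> /val_inj -> | case=> ->]. Qed.

Lemma cut_Gamma_le1 (W : block WW) (N : {set ext_vertex K WW}) :
  stable (@Gamma_incl G K WW @^-1: N) -> (#|N :&: cut W| <= 1)%N.
Proof.
apply: clique_trace_le1 => e e' eW e'W nee.
have [a ae] := cut_Gamma eW; have [b be] := cut_Gamma e'W.
exists a, b; split=> //; move: eW e'W nee; rewrite -ae -be !inE.
case: a b {ae be} => [k|r] [l|s] //= rW sW.
by rewrite (eqP rW) (eqP sW) eqxx.
Qed.

Lemma cut_GKW_le1 (W : block WW) (N : {set ext_vertex K WW}) :
  stable (@GKW_incl G K WW W @^-1: N) -> (#|N :&: cut W| <= 1)%N.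
Proof.
apply: clique_trace_le1 => e e' eW e'W nee.
have [a ae] := cut_GKW eW; have [b be] := cut_GKW e'W.
exists a, b; split=> //; move: eW e'W nee; rewrite -ae -be !inE.
case: a b {ae be} => [k|X] [l|Y] /= rW sW.
- exact: clique_neq_adj.
- by rewrite /GKW_cross rW orbT.
- by rewrite /GKW_cross sW orbT.
by apply: contraNneq => ->.
Qed.

Lemma Gamma_meets_cut (W : block WW) (N : {set ext_vertex K WW}) :
    (forall C, C \in Gamma_cliques K WW ->
       @Gamma_incl G K WW @^-1: N :&: C != set0) ->
  (0 < #|N :&: cut W|)%N.
Proof.
move=> meet; have /set0Pn[a] := meet _ (imset_f _ (in_setT W)).
rewrite !inE => /andP[aN aW]; rewrite card_gt0; apply/set0Pn.
exists (Gamma_incl a); rewrite !inE aN /=.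
by case: a aW {aN} => [k _|r] //=; apply: valP.
Qed.

(** * Gluing stable sets that agree on the shared cliques *)

Definition glue (S : {set ext_vertex K WW})
    (T : {ffun block WW -> {set ext_vertex K WW}}) : {set G} :=
  [set v | if v \in K then inl v \in S
           else [exists W : block WW, (v \in val W) && (inl v \in T W)]].

Lemma glue_clique S T v : v \in K -> (v \in glue S T) = (inl v \in S).
Proof. by rewrite inE => ->. Qed.

Lemma glue_block S T (W : block WW) v : v \in val W ->
  (v \in glue S T) = (inl v \in T W).
Proof.
move=> vW; rewrite inE (negPf (block_notin_clique (valP W) vW)).
apply/existsP/idP => [[W' /andP[vW']]|vT]; last by exists W; rewrite vW.
by rewrite (block_inj vW' vW).
Qed.

Lemma stable_glue (S : {set ext_vertex K WW})
    (T : {ffun block WW -> {set ext_vertex K WW}}) :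
    stable (@Gamma_incl G K WW @^-1: S) ->
    (forall W, stable (@GKW_incl G K WW W @^-1: T W)) ->
    (forall W, S :&: cut W = T W :&: cut W) ->
    (forall W, #|S :&: cut W| = 1%N) ->
  stable (glue S T).
Proof.
move=> /stableP stS stT ST S1.
have ST_cut W e : e \in cut W -> (e \in S) = (e \in T W).
  by move=> eW; move/setP/(_ e): (ST W); rewrite !in_setI eW !andbT.
have TP W u v : u \in K :|: val W -> v \in K :|: val W ->
    inl u \in T W -> inl v \in T W -> ~~ adj u v.
  move=> uW vW uT vT; have /stableP st := stT W.
  by apply: (st (inl (Sub u uW)) (inl (Sub v vW))); rewrite inE.
have one_clique u v : u \in K -> v \notin K ->
    u \in glue S T -> v \in glue S T -> ~~ adj u v.
  move=> uK vK; have [W vW] := block_exists vK.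
  rewrite (glue_clique _ _ uK) (glue_block _ _ vW) (ST_cut W) ?inE // => uT vT.
  by apply: (TP W); rewrite ?inE ?uK ?vW ?orbT.
apply/stableP => u v uU vU.
have [uK|uK] := boolP (u \in K); have [vK|vK] := boolP (v \in K).
- move: uU vU; rewrite !glue_clique // => uS vS.
  have := stS (inl (Sub u uK)) (inl (Sub v vK)); rewrite !inE uS vS /=.
  by move=> /(_ isT isT); rewrite negbK => /eqP[->]; rewrite adj_irr.
- exact: one_clique.
- by rewrite adj_sym; apply: one_clique.
have [W uW] := block_exists uK; have [W' vW'] := block_exists vK.
move: uU vU; rewrite (glue_block _ _ uW) (glue_block _ _ vW') => uT vT.
have [WW'|WW'] := eqVneq W W'.
  by rewrite -WW' in vT vW'; apply: (TP W); rewrite ?inE ?uW ?vW' ?orbT.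
apply/negP => uv.
(* The remaining case is an edge between two blocks; both ends are then boundary nodes, adjacent to
   all of [K]. *)
have uB := cross_boundary WW' uW vW' uv.
have vB : v \in boundary K (val W').
  by apply: (cross_boundary _ vW' uW); rewrite 1?eq_sym 1?adj_sym.
have noK k : k \in K -> inl k \notin S.
  move=> kK; apply/negP; rewrite (ST_cut W) ?inE // => kT.
  have := TP W u k; rewrite !inE uW kK orbT /= => /(_ isT isT uT kT).
  by rewrite (boundary_adj uB kK).
(* The single node of [S] in [cut W0] is not in [K], so it is some [r_X], which also lies in [T W0].
   Stability of [T W0] forbids an edge from [w] to [r_X], which puts [w] in the union of [X]. *)
have trace W0 w : w \in boundary K (val W0) -> inl w \in T W0 ->
    exists r : newnode K WW, [/\ tag r = W0, inr r \in S & w \in new_union r].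
  move=> wB wT; have /eqP/cards1P[e Se] := S1 W0.
  have : e \in S :&: cut W0 by rewrite Se inE.
  case: e {Se} => [k|r] /setIP[eS]; rewrite inE => eW.
    by rewrite (negPf (noK k eW)) in eS.
  exists r; split=> //; first exact/eqP.
  case: r eW eS => [W1 X] /= /eqP WE; case: _ / WE in wB wT *.
  rewrite (ST_cut W1) ?inE //= => XT.
  have wKW : w \in K :|: val W1.
    by move: wB; rewrite !inE => /andP[-> _]; rewrite orbT.
  have /stableP/(_ (inl (Sub w wKW)) (inr X)) := stT W1.
  rewrite !inE /= => /(_ wT XT); rewrite /GKW_cross inE wB andbT negb_or negbK.
  by case/andP.
have [r [rW rS ur]] := trace W u uB uT.
have [s [sW sS vs]] := trace W' v vB vT.
have := stS (inr r) (inr s); rewrite !inE => /(_ rS sS) /=.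
rewrite rW sW (negPf WW') => /negP; apply; apply/existsP; exists u.
by rewrite ur; apply/existsP; exists v; rewrite vs.
Qed.

End Separation.

(** * The two inclusions between [P(G)] and the projection *)

Theorem theorem11 (R : realType) (G : sgraph) (K : {set G})
    (WW : {set {set G}}) (sepKW : amalgam_separation K WW) (clK : clique K)
    (y : {ffun G -> R^o}) :
  stable_polytope (G := G) set0 y <->
  exists x : {ffun ext_vertex K WW -> R^o},
    [/\ stable_polytope (Gamma_cliques K WW) (restrict (@Gamma_incl G K WW) x),
        forall W : block WW,
          stable_polytope (G := GKW K (val W)) set0
            (restrict (@GKW_incl G K WW W) x)
      & y = restrict (@G_incl G K WW) x].
Proof.
split=> [yP|[x [xGamma xGKW ->]]].
  have restrict_id : y = restrict id y by apply/ffunP => v; rewrite ffunE.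
  rewrite restrict_id in yP.
  have [c [c0 c1 cS yE]] := restrict_polytope_elim (@inj_id G) yP.
  have preid (S : {set G}) : id @^-1: S = S by apply/setP => v; rewrite inE.
  have stS S : c S != 0 -> stable S by move=> /cS[]; rewrite preid.
  (* The witness is the mean of the extension of the random stable set with law [c]. *)
  exists [ffun e => \sum_S c S * (e \in extend K WW S)%:R]; split.
  - apply: (restrict_polytope_intro (N := extend K WW) c0 c1) => [S /stS st|a].
      by split=> [|C]; [apply: stable_extend_Gamma | apply: extend_meets].
    by rewrite ffunE.
  - move=> W.
    apply: (restrict_polytope_intro (N := extend K WW) c0 c1) => [S /stS st|a].
      by split=> [|C]; [apply: stable_extend_GKW | rewrite inE].
    by rewrite ffunE.
  by apply/ffunP => v; rewrite !ffunE yE; apply: eq_bigr => S _; rewrite inE.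
have [la [la0 la1 laS xla]] :=
  restrict_polytope_elim (@Gamma_incl_inj G K WW) xGamma.
have /fin_all_exists[mu muP] W :=
  restrict_polytope_elim (@GKW_incl_inj G K WW W) (xGKW W).
have mu0 W : forall T, 0 <= mu W T by have [] := muP W.
have mu1 W : \sum_T mu W T = 1 by have [] := muP W.
have muT W T : mu W T != 0 -> stable (@GKW_incl G K WW W @^-1: T).
  by have [_ _ st _] := muP W => /st[].
have xmu W a : x (@GKW_incl G K WW W a) =
    \sum_T mu W T * (GKW_incl a \in T)%:R by have [] := muP W.
have la_cut W S : la S != 0 -> #|S :&: cut K W| = 1%N.
  move=> /laS[st meet]; apply/eqP; rewrite eqn_leq cut_Gamma_le1 //.
  exact: Gamma_meets_cut.
have cutE W e : e \in cut K W ->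
    \sum_S la S * (e \in S)%:R = \sum_T mu W T * (e \in T)%:R.
  move=> eW; have [a ae] := cut_Gamma eW; have [b be] := cut_GKW eW.
  transitivity (x e); first by rewrite -ae xla.
  by rewrite -be xmu.
(* No clique condition is imposed on [G(K, W)]. But the mean trace size depends only on the node
   marginals on the cut, which agree with those of [la], so it is 1. *)
have mu_cut W T : mu W T != 0 -> #|T :&: cut K W| = 1%N.
  apply: trace_card1 => // [U /muT|]; first exact: cut_GKW_le1.
  rewrite sum_weight_trace -(eq_bigr _ (cutE W)) -sum_weight_trace -[RHS]la1.
  apply: eq_bigr => S _; have [->|/la_cut->] := eqVneq (la S) 0.
    by rewrite mul0r.
  by rewrite mulr1.
(* The conditioning variable for block [W] is the trace on [cut W]. *)
have [rho [rho0 rho1 rhoN rho_la rho_mu]] :=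
  weighted_glue (f := fun W S => S :&: cut K W) (g := fun W T => T :&: cut K W)
    la0 la1 mu0 mu1
    (fun W => trace_weight_eq (la_cut W) (mu_cut W) (cutE W)).
have G_incl_inj : injective (@G_incl G K WW) by move=> u u' [].
apply: (restrict_polytope_intro
  (N := fun w => @G_incl G K WW @: glue w.1 w.2) rho0 rho1) => [w rw|v].
  split=> [|C]; last by rewrite inE.
  have -> : @G_incl G K WW @^-1: (@G_incl G K WW @: glue w.1 w.2) =
      glue w.1 w.2.
    by apply/setP => v; rewrite inE mem_imset.
  have [law muw] := rhoN w rw.
  apply: stable_glue => // [|W|W|W].
  - by have [] := laS _ law.
  - by apply: muT; have [] := muw W.
  - by have [] := muw W.
  exact: la_cut.
under eq_bigr do rewrite mem_imset //.
(* Nodes of [K] get their mean from the marginal [la], nodes of a block [W] from the marginal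
   [mu W]; both reproduce [x]. *)
have [vK|vK] := boolP (v \in K).
  rewrite (xla (inl (Sub v vK))) -rho_la; apply: eq_bigr => w _.
  by rewrite glue_clique.
have [W vW] := block_exists sepKW vK.
have vKW : v \in K :|: val W by rewrite inE vW orbT.
rewrite (xmu W (inl (Sub v vKW))) -(rho_mu W); apply: eq_bigr => w _.
by rewrite (glue_block sepKW _ _ vW).
Qed.
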